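(* For all integers $r\geq 1$ and $k\geq 2$, $$\mathrm{ex}(n,C_{2k}[r])=O\left(n^{2-\frac{1}{r}+\frac{1}{k+r-1}}(\log n)^{\frac{4k}{r(k+r-1)}}\right).$$
   Context: For a graph $F$, the $r$-blowup $F[r]$ is obtained by replacing each vertex of $F$ by an independent set of size $r$ and each edge of $F$ by a complete bipartite graph $K_{r,r}$. $\mathrm{ex}(n,H)$ is the maximum number of edges in an $n$-vertex graph with no subgraph isomorphic to $H$. Logarithms are base $2$. *)

(* Defs.v *)
From Stdlib Require Import Reals.
From mathcomp Require Import all_boot.
Set Implicit Arguments. Unset Strict Implicit. Unset Printing Implicit Defensive.

Definition simple_edges (V : finType) (E : {set {set V}}) : bool :=
  [forall e in E, #|e| == 2].

Definition contains_subgraph (W V : finType) (EF : {set {set W}}) (E : {set {set V}}) : bool :=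
  [exists f : {ffun W -> V}, injectiveb f && [forall e in EF, f @: e \in E]].

Definition ex (W : finType) (EF : {set {set W}}) (n : nat) : nat :=
  \max_(E : {set {set 'I_n}} | simple_edges E && ~~ contains_subgraph EF E) #|E|.

(* The cycle C_m on vertex set 'I_m (meant for m >= 3): i ~ i+1 mod m. *)
Definition cycle_edges (m : nat) : {set {set 'I_m}} :=
  [set e : {set 'I_m} | [exists i : 'I_m, exists j : 'I_m,
     (e == [set i; j]) && (val j == (val i).+1 %% m)]].

Definition blowup_edges (W : finType) (EF : {set {set W}}) (r : nat)
  : {set {set (W * 'I_r)%type}} :=
  [set e : {set (W * 'I_r)%type} | [exists p : (W * 'I_r)%type, exists q : (W * 'I_r)%type,
     (e == [set p; q]) && ([set p.1; q.1] \in EF)]].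

Definition log2 (x : R) : R := Rdiv (ln x) (ln (INR 2)).

(* Main.v *)
Require Import Defs.
From Stdlib Require Import Reals.
From mathcomp Require Import all_boot.
From mathcomp Require Import zify.
From Stdlib Require Import Lra.

(* Let [G] be a graph with adjacency [adj] and work in the graph on [r]-tuples of vertices
   where [S] and [U] are adjacent when all [S a], [U b] are; the degree of [S] is [c(S) ^ r],
   with [c(S)] the size of its common neighbourhood. A closed walk of length [2 k] there whose
   tuples are injective and pairwise disjoint is a copy of [C_2k[r]].

   For a subgraph [B] of the tuple graph let [h_j] be the number of closed walks of length
   [2 j]. If every closed walk of length [2 k] has a clash, Cauchy-Schwarz gives
   [h_k <= 4 k ^ 4 M h_(k-1)], where [M] is about [c(u) ^ (r-1) c(x) ^ r] for adjacent [u], [x]: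
   given [u], a vertex [x] of the walk that clashes with a prescribed tuple has one coordinate
   less to choose. By log-convexity of [h], [h_k <= (4 k ^ 4 M) ^ (k-1) h_1]. It matters that the
   interpolation is with [h_1], the number of edges, rather than [h_0]. On the other hand,
   when [B] is bipartite, [h_k] is at least the [k]-th power of the product of the average
   degrees of the two sides.

   To make the maximal and average degrees of [B] comparable, [B] is taken between two dyadic
   classes of [c] carrying a fraction [1 / log^2 n] of all adjacent pairs; tuples with small [c]
   are discarded first, which loses only a constant factor. *)

Set Implicit Arguments.
Unset Strict Implicit.
Unset Printing Implicit Defensive.

(** * Inequalities for finite sums and log-convex sequences *)

Lemma leq_expl m n e : m <= n -> m ^ e <= n ^ e.
Proof. by case: e => // e le_mn; rewrite leq_exp2r. Qed.

Lemma card_sum (T : finType) (P : pred T) : #|P| = \sum_x P x.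
Proof.
rewrite -sum1_card big_mkcond; apply: eq_bigr => x _.
by have -> : (x \in P) = P x by []; case: (P x).
Qed.

(** Cauchy-Schwarz over [nat]. After doubling, both sides are sums over pairs [(i, j)], compared
    termwise by AM-GM for [a i * b j] and [a j * b i]. *)
Lemma sum_mul_sq_le (I : finType) (P : pred I) (a b : I -> nat) :
  (\sum_(i | P i) a i * b i) ^ 2
    <= (\sum_(i | P i) a i ^ 2) * (\sum_(i | P i) b i ^ 2).
Proof.
have dbl x y : x.*2 <= y.*2 -> x <= y by rewrite leq_double.
apply: dbl.
rewrite -!addnn {2}[(\sum_(i | P i) a i ^ 2) * _]mulnC -mulnn !big_distrlr /=.
rewrite -!big_split /=.
apply: leq_sum => i _; rewrite -!big_split /=; apply: leq_sum => j _.
have [+ _] := nat_Cauchy (a i * b j) (a j * b i).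
rewrite -!mulnn; nia.
Qed.

Lemma sum_sq_le (I : finType) (P : pred I) (a : I -> nat) :
  (\sum_(i | P i) a i) ^ 2 <= #|[set i | P i]| * \sum_(i | P i) a i ^ 2.
Proof.
have -> : #|[set i | P i]| = \sum_(i | P i) 1 ^ 2.
  by rewrite exp1n sum1_card cardsE.
have := sum_mul_sq_le P (fun=> 1) a.
by under eq_bigr do rewrite mul1n.
Qed.

(* Chebyshev's sum inequality for [a] and [a ^ r] *)
Lemma sum_mul_expn_le (I : finType) (a : I -> nat) r :
  (\sum_i a i) * (\sum_i a i ^ r) <= #|I| * \sum_i a i ^ r.+1.
Proof.
have dbl x y : x.*2 <= y.*2 -> x <= y by rewrite leq_double.
apply: dbl.
have -> : #|I| * (\sum_i a i ^ r.+1) = \sum_(i : I) \sum_(j : I) a j ^ r.+1.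
  by rewrite sum_nat_const.
rewrite -addnn -[X in _ <= X]addnn [X in _ <= X + _]exchange_big /=.
rewrite {2}mulnC !big_distrlr /= -!big_split /=.
apply: leq_sum => i _; rewrite -!big_split /=; apply: leq_sum => j _.
rewrite !expnS.
by case: (leqP (a i) (a j)) => [|/ltnW] le_ij; have := leq_expl r le_ij; nia.
Qed.

Lemma expn_sum_le (I : finType) (a : I -> nat) r :
  (\sum_i a i) ^ r.+1 <= #|I| ^ r * \sum_i a i ^ r.+1.
Proof.
elim: r => [|r IHr]; first by rewrite mul1n.
rewrite expnS (leq_trans (leq_mul (leqnn _) IHr)) //.
rewrite mulnCA expnSr -mulnA leq_mul2l sum_mul_expn_le orbT //.
Qed.

(** The ratios [a j.+1 / a j] are nondecreasing, so each of the [k] ratios leading from [a 1] to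
    [a k.+1] is at least [a 1 / a 0]. *)
Lemma log_convex_first (a : nat -> nat) k :
  (forall j, a j.+1 ^ 2 <= a j * a j.+2) -> a 1 ^ k.+1 <= a 0 ^ k * a k.+1.
Proof.
move=> convex; case: (posnP (a 1)) => [->|a1]; first by rewrite exp0n.
(* Positivity is carried along in the induction, since the ratio comparison cancels [a j.+1]. *)
have ratio j : 0 < a j.+1 /\ a 1 * a j <= a 0 * a j.+1.
  elim: j => [|j [pos IHj]]; first by rewrite mulnC.
  have := convex j; rewrite -mulnn => cj.
  have : 0 < a j * a j.+2 by rewrite (leq_trans _ cj) // muln_gt0 pos.
  rewrite muln_gt0 => /andP[aj aj2]; split=> //.
  rewrite -(leq_pmul2r aj) mulnAC (leq_trans (leq_mul IHj (leqnn _))) //.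
  by rewrite -!mulnA leq_mul2l [a j.+2 * _]mulnC cj orbT.
elim: k => [|k IHk]; first by rewrite mul1n.
have [_ /(leq_mul IHk)] := ratio k.+1.
have [pos _] := ratio k.
rewrite [a 1 ^ k.+2]expnS [a 0 ^ k.+1]expnS => le.
rewrite -(leq_pmul2r pos); lia.
Qed.

(** The last ratio is the largest, so a bound on it holds for all ratios; multiplying only those
    above [a 1] leaves the exponent [k]. *)
Lemma log_convex_last (a : nat -> nat) M k :
    (forall j, a j.+1 ^ 2 <= a j * a j.+2) ->
  a k.+1 <= M * a k -> a k.+1 <= M ^ k * a 1.
Proof.
move=> convex; elim: k => [|k IHk] last; first by rewrite mul1n.
have [a0|pos] := posnP (a k.+1); first by move: last; rewrite a0 muln0 leqn0 => /eqP->.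
have := convex k; rewrite -mulnn => ck.
have /IHk le : a k.+1 <= M * a k.
  by rewrite -(leq_pmul2r pos) (leq_trans ck) // -mulnA [M * _]mulnCA leq_mul2l last orbT.
by rewrite expnS -mulnA (leq_trans last) // leq_mul2l le orbT.
Qed.

(** * Walk counts and their norms *)

Fixpoint walks (T : finType) (B : rel T) (j : nat) (x y : T) : nat :=
  if j is j'.+1 then \sum_z B x z * walks B j' z y else x == y.

(* The trace of [B ^ (2 j)]: the number of homomorphisms from [C_2j] to [B] *)
Definition walks_norm (T : finType) (B : rel T) (j : nat) : nat :=
  \sum_x \sum_y walks B j x y ^ 2.

Lemma sum_eq_mull (T : finType) (x : T) (F : T -> nat) :
  \sum_y (x == y) * F y = F x.
Proof.
rewrite (bigD1 x) //= eqxx mul1n big1 ?addn0 // => y.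
by rewrite eq_sym => /negbTE ->.
Qed.

Lemma walksD (T : finType) (B : rel T) i j x y :
  walks B (i + j) x y = \sum_z walks B i x z * walks B j z y.
Proof.
elim: i x => [|i IHi] x /=; first by rewrite sum_eq_mull.
under eq_bigr do rewrite IHi big_distrr /=.
rewrite exchange_big /=; apply: eq_bigr => z _.
by rewrite big_distrl /=; apply: eq_bigr => w _; rewrite mulnA.
Qed.

Lemma walks1 (T : finType) (B : rel T) x y : walks B 1 x y = B x y.
Proof. by rewrite /=; under eq_bigr do rewrite mulnC eq_sym; exact: sum_eq_mull. Qed.

Lemma walksC (T : finType) (B : rel T) j x y :
  symmetric B -> walks B j x y = walks B j y x.
Proof.
move=> symB; elim: j x y => [|j IHj] x y /=; first by rewrite eq_sym.
rewrite -[RHS]/(walks B j.+1 y x) -addn1 walksD.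
by apply: eq_bigr => z _; rewrite walks1 symB IHj mulnC.
Qed.

(** Only [i + j] matters on the right. This lets the middle term of a log-convexity inequality be
    rewritten as an inner product of its two neighbours, ready for Cauchy-Schwarz. *)
Lemma walks_inner (T : finType) (B : rel T) i j : symmetric B ->
  \sum_x \sum_y walks B i x y * walks B j x y = \sum_x walks B (i + j) x x.
Proof.
move=> symB; apply: eq_bigr => x _; rewrite walksD.
by apply: eq_bigr => y _; rewrite [walks B j x y]walksC.
Qed.

Lemma walks_norm_convex (T : finType) (B : rel T) j : symmetric B ->
  walks_norm B j.+1 ^ 2 <= walks_norm B j * walks_norm B j.+2.
Proof.
move=> symB; rewrite /walks_norm.
have -> : \sum_x \sum_y walks B j.+1 x y ^ 2 =
          \sum_x \sum_y walks B j x y * walks B j.+2 x y.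
  transitivity (\sum_x \sum_y walks B j.+1 x y * walks B j.+1 x y).
    by do 2![apply: eq_bigr => ? _]; rewrite mulnn.
  by rewrite !walks_inner // !addnS !addSn.
by rewrite !pair_bigA /=; apply: sum_mul_sq_le.
Qed.

Lemma walks_norm1 (T : finType) (B : rel T) :
  walks_norm B 1 = \sum_x \sum_y B x y.
Proof.
by do 2![apply: eq_bigr => ? _]; rewrite walks1; case: (B _ _).
Qed.

(** The vector obtained by applying [B ^ j] to the indicator of [X], for symmetric [B]. *)
Definition walks_from (T : finType) (B : rel T) (X : {set T}) (j : nat) (y : T) : nat :=
  \sum_(x in X) walks B j x y.

Lemma walks_from_convex (T : finType) (B : rel T) (X : {set T}) j : symmetric B ->
  (\sum_y walks_from B X j.+1 y ^ 2) ^ 2 <=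
    (\sum_y walks_from B X j y ^ 2) * (\sum_y walks_from B X j.+2 y ^ 2).
Proof.
move=> symB.
have inner i l : \sum_y walks_from B X i y * walks_from B X l y =
    \sum_(x in X) \sum_(x' in X) walks B (i + l) x x'.
  under eq_bigr do rewrite /walks_from big_distrlr /=.
  rewrite exchange_big /=; apply: eq_bigr => x _.
  rewrite exchange_big /=; apply: eq_bigr => x' _.
  by rewrite walksD; apply: eq_bigr => y _; rewrite [walks B l x' y]walksC.
have -> : \sum_y walks_from B X j.+1 y ^ 2 =
          \sum_y walks_from B X j y * walks_from B X j.+2 y.
  under eq_bigr do rewrite -mulnn.
  by rewrite !inner !addnS !addSn.
exact: sum_mul_sq_le.
Qed.

(* Test the operator norm of [B ^ k] against the indicator of [X]. *)
Lemma walks_norm_lower (T : finType) (B : rel T) (X Y : {set T}) k : symmetric B ->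
  (\sum_(x in X) \sum_(y in Y) B x y) ^ (2 * k.+1)
    <= (#|X| * #|Y|) ^ k.+1 * walks_norm B k.+1.
Proof.
move=> symB; set m := fun j => \sum_y walks_from B X j y ^ 2.
have m0 : m 0 = #|X|.
  rewrite /m -sum1_card [RHS]big_mkcond /=; apply: eq_bigr => y _.
  rewrite /walks_from /= big_mkcond /=.
  rewrite (bigD1 y) //= eqxx big1 ?addn0; first by case: (y \in X).
  by move=> x /negbTE ->; case: (x \in X).
have m1 : (\sum_(x in X) \sum_(y in Y) B x y) ^ 2 <= #|Y| * m 1.
  have -> : \sum_(x in X) \sum_(y in Y) B x y = \sum_(y in Y) walks_from B X 1 y.
    rewrite exchange_big; apply: eq_bigr => y _; rewrite /walks_from.
    by apply: eq_bigr => x _; rewrite walks1.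
  rewrite (leq_trans (sum_sq_le _ _)) // leq_mul //; first by rewrite cardsE.
  by rewrite [X in _ <= X](bigID (mem Y)) leq_addr.
have mk j : m j <= #|X| * walks_norm B j.
  rewrite /m /walks_norm exchange_big big_distrr /=.
  apply: leq_sum => y _; rewrite (leq_trans (sum_sq_le _ _)) // leq_mul //.
    by rewrite cardsE.
  by rewrite [X in _ <= X](bigID (mem X)) leq_addr.
have := log_convex_first k (fun j => walks_from_convex X j symB).
rewrite -/(m 0) -/(m 1) -/(m k.+1) m0 => le.
rewrite expnM.
apply: (leq_trans (n := (#|Y| * m 1) ^ k.+1)); first by rewrite leq_exp2r.
rewrite !expnMn mulnC.
apply: (leq_trans (leq_mul le (leqnn _))).
rewrite [#|X| ^ k.+1]expnSr -!mulnA leq_mul2l; apply/orP; right.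
by rewrite mulnCA [m _ * _]mulnC leq_mul2l mk orbT.
Qed.

(** * Closed walks as cyclic tuples, and the bad ones among them *)

Lemma sum_tupleS (T : finType) m (F : m.+1.-tuple T -> nat) :
  \sum_t F t = \sum_x \sum_(t : m.-tuple T) F [tuple of x :: t].
Proof.
rewrite pair_bigA /= (reindex (fun p : T * m.-tuple T => [tuple of p.1 :: p.2])) //=.
exists (fun t => (thead t, [tuple of behead t])) => [[x t] _|t _].
  by congr pair; apply: val_inj.
by rewrite [RHS]tuple_eta; apply: val_inj.
Qed.

(** The walk is split at its [l]-th vertex [z], the only place where [P] is tested. *)
Lemma sum_walk_tuples (T : finType) (B : rel T) m l (P : pred T) x y : l <= m ->
  \sum_(t : m.-tuple T) [&& path B x t, last x t == y & P (nth x (x :: t) l)]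
    = \sum_z walks B l x z * (P z * walks B (m - l) z y).
Proof.
elim: l m x => [|l IHl] m x.
  move=> _; rewrite subn0 sum_eq_mull /=.
  elim: m x (P x) => [|m IHm] x b.
    rewrite (bigD1 [tuple]) //= big1 ?addn0 => [|t]; last by rewrite (tuple0 t) => /eqP.
    by rewrite mulnC mulnb.
  rewrite sum_tupleS /= big_distrr /=; apply: eq_bigr => z _.
  by rewrite mulnCA -IHm big_distrr /=; apply: eq_bigr => t _; case: (B x z); rewrite ?mul1n.
case: m => // m lt_lm; rewrite subSS sum_tupleS /=.
under [RHS]eq_bigr do rewrite big_distrl /=.
rewrite [RHS]exchange_big /=; apply: eq_bigr => z _.
under [RHS]eq_bigr do rewrite -mulnA.
rewrite -big_distrr /= -IHl // big_distrr /=; apply: eq_bigr => t _.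
have -> : nth x (z :: t) l = nth z (z :: t) l.
  by apply: set_nth_default; rewrite /= size_tuple.
by case: (B x z); rewrite ?mul1n.
Qed.

Arguments walks : simpl never.

Lemma walksS (T : finType) (B : rel T) j x y :
  walks B j.+1 x y = \sum_z B x z * walks B j z y.
Proof. by []. Qed.

Lemma nth_rot (T : Type) (x0 : T) (s : seq T) i j :
  i <= size s -> j < size s -> nth x0 (rot i s) j = nth x0 s ((i + j) %% size s).
Proof.
move=> le_i lt_j; rewrite /rot nth_cat size_drop nth_drop.
case: ltnP => cmp; first by rewrite modn_small //; lia.
rewrite nth_take; last by lia.
congr nth; rewrite (_ : i + j = j - (size s - i) + size s); last by lia.
by rewrite modnDr modn_small //; lia.
Qed.

Lemma last_rotS (T : Type) (x0 : T) (s : seq T) i :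
  i < size s -> last x0 (rot i.+1 s) = nth x0 s i.
Proof.
by move=> lt_i; rewrite /rot (take_nth x0) // last_cat last_rcons.
Qed.

(** The walk is rooted at the first vertex of the bad pair. Distances start at one; those up to [k]
    suffice, because of two vertices of a closed walk one comes at most [k] steps after the
    other. *)
Definition bad_walks (T : finType) (B bad : rel T) k l : nat :=
  \sum_x \sum_z walks B l.+1 x z * (bad x z * walks B (2 * k - l.+1) z x).

Lemma count_bad_cycles (T : finType) (B bad : rel T) (x0 : T) k l i :
  i < 2 * k -> l < k ->
  \sum_(t : (2 * k).-tuple T)
     [&& cycle B t & bad (nth x0 t i) (nth x0 t ((i.+1 + l) %% (2 * k)))]
    = bad_walks B bad k l.
Proof.
move=> lt_i lt_l.
(* Rotating by [i.+1] moves position [i] to the end, and a cycle is a path that starts from its own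
   last vertex. *)
transitivity (\sum_(t : (2 * k).-tuple T) [&& cycle B t & bad (last x0 t) (nth x0 t l)]).
  pose rot_t (t : (2 * k).-tuple T) := [tuple of rot i.+1 t].
  rewrite [RHS](reindex_inj (h := rot_t)) /=; last first.
    by move=> t t' /(congr1 val) /= /rot_inj; apply: val_inj.
  apply: eq_bigr => t _; rewrite rot_cycle last_rotS ?nth_rot ?size_tuple //; lia.
transitivity (\sum_(t : (2 * k).-tuple T) \sum_x
    [&& path B x t, last x t == x & bad x (nth x (x :: t) l.+1)] : nat).
  apply: eq_bigr => t _.
  have lastE x : last x t = last x0 t.
    by case: t => [[|y s] //= /eqP]; lia.
  rewrite (bigD1 (last x0 t)) //= lastE eqxx big1 => [|x]; last first.
    by rewrite lastE eq_sym => /negbTE ->; rewrite andbF.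
  by rewrite addn0 -cycle_path (set_nth_default x0) // size_tuple; lia.
rewrite exchange_big /=; apply: eq_bigr => x _.
by apply: (@sum_walk_tuples _ B _ l.+1 (bad x)); lia.
Qed.

(* A bad cycle is cut at [x] and its antipode [y]; by Cauchy-Schwarz it is compared with
   pairs of bad half-cycles from [x] to [y]. A second Cauchy-Schwarz identifies their first
   steps [u], at the cost of a factor [deg x], while [x] is a neighbour of [u] constrained
   to be bad with respect to [z]. *)
Lemma bad_walks_le (T : finType) (B bad : rel T) k l M : symmetric B -> l <= k ->
    (forall u z, \sum_x #|B x| * (B x u * bad x z) <= M) ->
  bad_walks B bad k.+1 l ^ 2 <= M * walks_norm B k * walks_norm B k.+1.
Proof.
move=> symB le_lk boundM.
pose a x u y := \sum_z walks B l u z * (bad x z * walks B (k - l) z y).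
pose g x y := \sum_(u | B x u) a x u y.
have a_le x u y : a x u y <= walks B k u y.
  rewrite -[in X in _ <= X](subnKC le_lk) walksD; apply: leq_sum => z _.
  by rewrite leq_mul //; case: (bad x z); rewrite ?mul1n.
have -> : bad_walks B bad k.+1 l = \sum_x \sum_y g x y * walks B k.+1 x y.
  apply: eq_bigr => x _.
  (* From [z], another [k - l] steps lead to the antipode [y], and [k.+1] steps lead back to [x]. *)
  have -> : 2 * k.+1 - l.+1 = (k - l) + k.+1 by lia.
  transitivity (\sum_z \sum_u \sum_y B x u * (walks B l u z * (bad x z *
      walks B (k - l) z y)) * walks B k.+1 x y).
    apply: eq_bigr => z _; rewrite walksS [walks B (_ - _ + _) z x]walksD big_distrl /=.
    apply: eq_bigr => u _.
    rewrite !big_distrr /=; apply: eq_bigr => y _.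
    by rewrite [walks B k.+1 y x]walksC // !mulnA.
  rewrite exchange_big /=; under eq_bigr do rewrite exchange_big /=.
  rewrite exchange_big /=; apply: eq_bigr => y _.
  rewrite /g big_distrl /= [RHS]big_mkcond /=; apply: eq_bigr => u _.
  case: (B x u); last by rewrite big1.
  by rewrite /a big_distrl; apply: eq_bigr => z _; rewrite mul1n.
rewrite pair_bigA /= (leq_trans (sum_mul_sq_le _ _ _)) // leq_mul //; last first.
  by rewrite /walks_norm pair_bigA.
rewrite -(pair_bigA _ (fun x y => g x y ^ 2)) /=.
(* One of the two factors [a x u y] is relaxed to all walks from [u] to [y]; the other keeps the
   badness condition. *)
apply: (@leq_trans (\sum_x \sum_y #|B x| * \sum_(u | B x u) walks B k u y * a x u y)).
  do 2![apply: leq_sum => ? _]; rewrite (leq_trans (sum_sq_le _ _)) // leq_mul //.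
    by rewrite cardsE.
  by apply: leq_sum => u _; rewrite -mulnn leq_mul.
rewrite /walks_norm big_distrr /=.
rewrite exchange_big /= exchange_big.
under eq_bigr do under eq_bigr do rewrite big_distrr big_mkcond /=.
under eq_bigr do rewrite exchange_big /=.
rewrite exchange_big /=; apply: leq_sum => u _.
rewrite big_distrr exchange_big /=; apply: leq_sum => y _.
(* With [u], [y] and [z] fixed, the dependence on [x] is isolated in the sum controlled by
   [boundM]. *)
apply: (@leq_trans (\sum_x walks B k u y * \sum_z walks B l u z * walks B (k - l) z y
   * (#|B x| * (B x u * bad x z)))).
  apply: leq_sum => x _; case: (B x u) => //.
  rewrite mulnCA leq_mul2l /a big_distrr /=; apply/orP; right.
  by apply: leq_sum => z _; rewrite mul1n; lia.
rewrite -big_distrr /= -mulnn mulnCA leq_mul2l; apply/orP; right.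
rewrite exchange_big /= -[in X in _ <= _ * X](subnKC le_lk) walksD big_distrr /=.
apply: leq_sum => z _; rewrite -big_distrr /= mulnC leq_mul2r boundM orbT //.
Qed.

(** A union bound over the position and distance of a bad pair, combined with [bad_walks_le], bounds
    the last ratio of the sequence [walks_norm B]; log-convexity does the rest. The vertex [x0] is
    only a default for [nth]. *)
Lemma walks_norm_le (T : finType) (B bad : rel T) k M (x0 : T) : symmetric B ->
    (forall u z, \sum_x #|B x| * (B x u * bad x z) <= M) ->
    (forall t : (2 * k.+1).-tuple T, cycle B t -> exists i l,
       [/\ i < 2 * k.+1, l < k.+1
         & bad (nth x0 t i) (nth x0 t ((i.+1 + l) %% (2 * k.+1)))]) ->
  walks_norm B k.+1 <= (4 * k.+1 ^ 4 * M) ^ k * walks_norm B 1.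
Proof.
move=> symB boundM all_bad; apply: log_convex_last => [j|].
  exact: walks_norm_convex.
have cover : walks_norm B k.+1 <= 2 * k.+1 * \sum_(l < k.+1) bad_walks B bad k.+1 l.
  have -> : walks_norm B k.+1 = \sum_(t : (2 * k.+1).-tuple T) cycle B t.
    rewrite /walks_norm; transitivity (\sum_x walks B (k.+1 + k.+1) x x).
      by rewrite -walks_inner //; do 2![apply: eq_bigr => ? _]; rewrite mulnn.
    transitivity (bad_walks B (fun _ _ => true) k.+1 0).
      apply: eq_bigr => x _; have -> : k.+1 + k.+1 = 1 + (2 * k.+1 - 1) by lia.
      by rewrite walksD; apply: eq_bigr => z _; rewrite mul1n.
    rewrite -(@count_bad_cycles _ B (fun _ _ => true) x0 _ _ 0) //.
    by apply: eq_bigr => t _; rewrite andbT.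
  have -> : 2 * k.+1 * \sum_(l < k.+1) bad_walks B bad k.+1 l =
    \sum_(i < 2 * k.+1) \sum_(l < k.+1) bad_walks B bad k.+1 l.
    by rewrite sum_nat_const card_ord.
  have E (i : 'I_(2 * k.+1)) (l : 'I_k.+1) :=
    count_bad_cycles B bad x0 (ltn_ord i) (ltn_ord l).
  under [X in _ <= X]eq_bigr => i _ do under eq_bigr => l _ do rewrite -(E i l).
  under [X in _ <= X]eq_bigr do rewrite exchange_big /=.
  rewrite [X in _ <= X]exchange_big /=; apply: leq_sum => t _.
  case Bt: (cycle B t) => //; have [i [l [lt_i lt_l bad_il]]] := all_bad t Bt.
  by rewrite (bigD1 (Ordinal lt_i)) //= (bigD1 (Ordinal lt_l)) //= bad_il.
(* Squaring the [2 * k.+1] positions gives [4 * k.+1 ^ 2]; Cauchy-Schwarz over the [k.+1] distances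
   and then summing over them gives another [k.+1 ^ 2]. *)
have sq : walks_norm B k.+1 ^ 2 <=
    4 * k.+1 ^ 4 * M * walks_norm B k * walks_norm B k.+1.
  apply: (@leq_trans ((2 * k.+1 * \sum_(l < k.+1) bad_walks B bad k.+1 l) ^ 2)).
    by rewrite leq_sqr.
  rewrite expnMn; apply: (@leq_trans ((2 * k.+1) ^ 2 *
      (k.+1 * \sum_(l < k.+1) (M * walks_norm B k * walks_norm B k.+1)))).
    rewrite leq_mul2l (leq_trans (sum_sq_le _ _)) ?orbT // cardsT card_ord.
    rewrite leq_mul2l; apply/orP; right; apply: leq_sum => l _.
    by apply: bad_walks_le; rewrite // -ltnS.
  by rewrite sum_nat_const card_ord expnMn; lia.
have [->//|pos] := posnP (walks_norm B k.+1).
by rewrite -(leq_pmul2r pos) mulnn.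
Qed.

(** * The tuple graph and its clashes *)

Definition common_nbh (V : finType) (adj : rel V) r (S : {ffun 'I_r -> V}) : {set V} :=
  [set v | [forall a, adj (S a) v]].

(** Tuples may repeat entries, so that degrees are exact powers; repetitions are left to [clash]. *)
Definition tuple_adj (V : finType) (adj : rel V) r : rel {ffun 'I_r -> V} :=
  fun S U => [forall a, forall b, adj (S a) (U b)].

(* Also holds when [S] is not injective, so that a clash-free closed walk is an embedding
   of the blowup *)
Definition clash (V : finType) r (S U : {ffun 'I_r -> V}) : bool :=
  [exists a, exists b, (S a == U b) || (a != b) && (S a == S b)].

Lemma tuple_adjE (V : finType) (adj : rel V) r (S U : {ffun 'I_r -> V}) :
  tuple_adj adj S U = (U \in ffun_on (mem (common_nbh adj S))).
Proof.
apply/forallP/ffun_onP => [adjSU b|nbhU a].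
  by rewrite inE; apply/forallP => a; exact: forallP (adjSU a) b.
by apply/forallP => b; have := nbhU b; rewrite inE => /forallP.
Qed.

Lemma card_tuple_adj (V : finType) (adj : rel V) r (S : {ffun 'I_r -> V}) :
  #|tuple_adj adj S| = #|common_nbh adj S| ^ r.
Proof.
rewrite (eq_card (_ : _ =i ffun_on (mem (common_nbh adj S)))).
  by rewrite card_ffun_on card_ord.
by move=> U; rewrite -tuple_adjE.
Qed.

(** Overwriting coordinate [a] by a fixed value is injective on [A], and only the other coordinates
    then vary, within [N]. *)
Lemma card_determined_coord (I V : finType) (a : I) (N : {set V}) (A : {set {ffun I -> V}}) :
    (forall x, x \in A -> forall i, x i \in N) ->
    (forall x y, x \in A -> y \in A -> (forall i, i != a -> x i = y i) -> x a = y a) ->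
  #|A| <= #|N| ^ #|I|.-1.
Proof.
move=> subN det; have [->|[x0 _]] := set_0Vmem A; first by rewrite cards0.
pose F (x : {ffun I -> V}) := [ffun i => if i == a then x0 a else x i].
have injF : {in A &, injective F}.
  move=> x y xA yA /ffunP eqF.
  have eq_xy i : i != a -> x i = y i.
    by move=> ia; have := eqF i; rewrite !ffunE (negbTE ia).
  by apply/ffunP => i; have [->|] := eqVneq i a; [exact: det|exact: eq_xy].
rewrite -(card_in_imset injF) -[#|I|.-1](_ : #|predC1 a| = _); last first.
  by rewrite (cardC1 a).
rewrite -(card_pffun_on (x0 a)); apply: subset_leq_card.
apply/subsetP => _ /imsetP[x xA ->]; apply/pffun_onP; split.
  apply/supportP => i; rewrite inE negbK => /eqP ->.
  by rewrite ffunE eqxx.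
by move=> v /imageP[i]; rewrite inE => ia ->; rewrite ffunE (negbTE ia) subN.
Qed.

(** For each pair [(a, b)] and each of the two kinds of clash, the entry [x a] is determined by [z]
    or by the other entries of [x]. *)
Lemma count_clash (V : finType) (adj : rel V) r (u z : {ffun 'I_r -> V}) :
  \sum_x (tuple_adj adj u x && clash x z) <= 2 * r ^ 2 * #|common_nbh adj u| ^ r.-1.
Proof.
set N := common_nbh adj u.
have inN x i : tuple_adj adj u x -> x i \in N.
  by rewrite tuple_adjE => /ffun_onP/(_ i).
have card_le (P : 'I_r -> 'I_r -> pred {ffun 'I_r -> V}) a b :
    (forall x y, P a b x -> P a b y -> (forall i, i != a -> x i = y i) -> x a = y a) ->
  \sum_x (tuple_adj adj u x && P a b x) <= #|N| ^ r.-1.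
  move=> det.
  have -> : \sum_x (tuple_adj adj u x && P a b x) = #|[set x | tuple_adj adj u x && P a b x]|.
    by rewrite -sum1_card [RHS]big_mkcond; apply: eq_bigr => x _; rewrite inE; case: andP.
  have := @card_determined_coord 'I_r V a N; rewrite card_ord.
  apply => [x|x y]; rewrite !inE.
    by case/andP=> + _ i; exact: inN.
  by case/andP=> _ Px /andP[_ Py]; exact: det.
apply: (@leq_trans (\sum_(a < r) \sum_(b < r) (\sum_x (tuple_adj adj u x && (x a == z b))
   + \sum_x (tuple_adj adj u x && ((a != b) && (x a == x b)))))).
  under [X in _ <= X]eq_bigr do under eq_bigr do rewrite -big_split /=.
  under [X in _ <= X]eq_bigr do rewrite exchange_big /=.
  rewrite [X in _ <= X]exchange_big /=; apply: leq_sum => x _.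
  case: (tuple_adj adj u x) => //=; case clash_xz: (clash x z) => //.
  have /existsP[a /existsP[b ab]] := clash_xz.
  rewrite (bigD1 a) //= (bigD1 b) //=.
  by case/orP: ab => ->; rewrite ?addnS.
apply: (@leq_trans (\sum_(a < r) \sum_(b < r) (2 * #|N| ^ r.-1))).
  do 2![apply: leq_sum => ? _]; rewrite mul2n -addnn leq_add //.
    by apply: (card_le (fun a b x => x a == z b)) => x y /eqP-> /eqP->.
  apply: (card_le (fun a b x => (a != b) && (x a == x b))) => x y.
  move=> /andP[ab /eqP->] /andP[_ /eqP->]; apply; by rewrite eq_sym.
by rewrite !sum_nat_const card_ord; lia.
Qed.

(** The largest degree among the neighbours of [u] is pulled out of the sum. It is attained at a
    neighbour [x2], so the bound [Q] applies to the edge from [x2] to [u]. *)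
Lemma clash_degree_le (V : finType) (adj : rel V) r (B : rel {ffun 'I_r -> V}) Q
    (u z : {ffun 'I_r -> V}) : symmetric B ->
    (forall x y, B x y -> tuple_adj adj x y) ->
    (forall x y, B x y ->
       #|common_nbh adj x| ^ r * #|common_nbh adj y| ^ r.-1 <= Q) ->
  \sum_x #|B x| * (B x u * clash x z) <= 2 * r ^ 2 * Q.
Proof.
move=> symB subB boundQ.
have [x1 B1|noB] := pickP (B u); last first.
  by rewrite big1 // => x _; rewrite symB noB muln0.
case: (arg_maxnP (fun x => #|B x|) B1) => x2 B2 max2.
apply: (@leq_trans (\sum_x #|B x2| * (tuple_adj adj u x && clash x z))).
  apply: leq_sum => x _; rewrite symB; case Bux: (B u x); last by rewrite muln0.
  by rewrite (subB _ _ Bux) mul1n leq_mul //; exact: max2.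
rewrite -big_distrr /= (leq_trans (leq_mul (leqnn _) (count_clash _ _ _))) //.
rewrite mulnCA leq_mul //.
rewrite symB in B2; rewrite (leq_trans _ (boundQ _ _ B2)) // leq_mul //.
by rewrite -card_tuple_adj; apply: subset_leq_card; apply/subsetP => x; apply: subB.
Qed.

Lemma cycle_nth (T : Type) (e : rel T) (x0 : T) (s : seq T) i :
  cycle e s -> i < size s -> e (nth x0 s i) (nth x0 s (i.+1 %% size s)).
Proof.
case: s => // x p /= /(pathP x0) cyc lt_i.
have := cyc i; rewrite size_rcons => /(_ lt_i).
rewrite -rcons_cons !nth_rcons /= lt_i.
case: ltnP => [lt|le]; first by rewrite modn_small.
have -> : i = size p by apply/eqP; rewrite eqn_leq le -ltnS lt_i.
by rewrite eqxx modnn.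
Qed.

Definition edge_rel (V : finType) (E : {set {set V}}) : rel V :=
  fun u v => [set u; v] \in E.

Lemma edge_relC (V : finType) (E : {set {set V}}) : symmetric (edge_rel E).
Proof. by move=> u v; rewrite /edge_rel setUC. Qed.

(** The entries of the tuples define a map from the blowup that sends edges to edges. It cannot be
    injective, and a collision within one tuple or between two tuples is a clash. *)
Lemma clash_of_free (V : finType) (E : {set {set V}}) r k (x0 : {ffun 'I_r -> V})
    (t : (2 * k).-tuple {ffun 'I_r -> V}) :
    ~~ contains_subgraph (blowup_edges (cycle_edges (2 * k)) r) E -> 0 < k ->
    cycle (tuple_adj (edge_rel E) (r := r)) t ->
  exists i l, [/\ i < 2 * k, l < k
     & clash (nth x0 t i) (nth x0 t ((i.+1 + l) %% (2 * k)))].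
Proof.
move=> free k0 cyc.
pose f : {ffun 'I_(2 * k) * 'I_r -> V} := [ffun p : 'I_(2 * k) * 'I_r => nth x0 t p.1 p.2].
have edges e : e \in blowup_edges (cycle_edges (2 * k)) r -> f @: e \in E.
  rewrite inE => /existsP[p /existsP[q /andP[/eqP-> pq]]].
  have step (i j : 'I_(2 * k)) a b : val j == (val i).+1 %% (2 * k) ->
      [set nth x0 t i a; nth x0 t j b] \in E.
    move=> /eqP /= ->; have := cycle_nth x0 cyc (i := i); rewrite size_tuple.
    by move=> /(_ (ltn_ord i)) /forallP/(_ a) /forallP/(_ b).
  rewrite imsetU1 imset_set1 !ffunE.
  move: pq; rewrite inE => /existsP[i /existsP[j /andP[/eqP eq_set ij]]].
  have : i \in [set p.1; q.1] by rewrite eq_set set21.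
  have : j \in [set p.1; q.1] by rewrite eq_set set22.
  have : p.1 \in [set i; j] by rewrite -eq_set set21.
  have : q.1 \in [set i; j] by rewrite -eq_set set22.
  rewrite !inE => qij pij jpq ipq.
  have [[-> ->]|[-> ->]] : p.1 = i /\ q.1 = j \/ p.1 = j /\ q.1 = i; last 2 first.
  - exact: step.
  - by rewrite setUC; exact: step.
  case/orP: pij => /eqP p1; case/orP: qij => /eqP q1; rewrite p1 q1 in jpq ipq *; auto.
    by move: jpq; rewrite orbb => /eqP->; auto.
  by move: ipq; rewrite orbb => /eqP->; auto.
have /injectivePn[p [q pq]] : ~~ injectiveb f.
  apply/negP => injf; case/negP: free; apply/existsP; exists f; rewrite injf.
  by apply/forall_inP.
rewrite !ffunE => f_pq.
have [eq1|ne1] := eqVneq p.1 q.1.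
  (* The repetition lies inside the first tuple alone, so any distance would do. *)
  exists p.1, 0; split=> //.
  apply/existsP; exists p.2; apply/existsP; exists q.2.
  rewrite [X in _ || X](_ : _ = true) ?orbT //; apply/andP; split.
    by apply: contra pq => /eqP eq2; rewrite [p]surjective_pairing eq1 eq2 -surjective_pairing.
  by rewrite f_pq eq1.
have meet (i j : 'I_(2 * k)) a b : i < j -> nth x0 t i a = nth x0 t j b ->
  exists i l, [/\ i < 2 * k, l < k
     & clash (nth x0 t i) (nth x0 t ((i.+1 + l) %% (2 * k)))].
  (* If [j] is more than [k] steps after [i], then going round the cycle [i] is fewer than [k] steps
     after [j]. *)
  have := ltn_ord j; move=> lt_j lt_ij eq_ab; case: (leqP (j - i) k) => dist.
    exists i, (j - i).-1; split; [exact: ltn_ord|lia|].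
    have -> : i.+1 + (j - i).-1 = j by lia.
    rewrite modn_small //; apply/existsP; exists a; apply/existsP; exists b.
    by rewrite eq_ab eqxx.
  exists j, (i + 2 * k - j).-1; split=> //; first lia.
  have -> : j.+1 + (i + 2 * k - j).-1 = i + 2 * k by lia.
  rewrite modnDr modn_small //; apply/existsP; exists b; apply/existsP; exists a.
  by rewrite eq_ab eqxx.
case: (ltngtP p.1 q.1) => [lt|gt|eq]; [exact: meet f_pq|exact: meet (esym f_pq)|].
by case/eqP: ne1; apply: val_inj.
Qed.

Lemma tuple_adjC (V : finType) (adj : rel V) r : symmetric adj ->
  symmetric (tuple_adj adj (r := r)).
Proof.
move=> symA S U; apply/forallP/forallP => adjSU b; apply/forallP => a;
  by rewrite symA; exact: forallP (adjSU a) b.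
Qed.

(** * Adjacent pairs between two classes of tuples *)

Definition adj_count (V : finType) (adj : rel V) r (X Y : {set {ffun 'I_r -> V}}) : nat :=
  \sum_(S in X) \sum_(U in Y) tuple_adj adj S U.

Lemma adj_countE (V : finType) (adj : rel V) r (X Y : {set {ffun 'I_r -> V}}) :
  adj_count adj X Y = \sum_S \sum_U (tuple_adj adj S U && ((S \in X) && (U \in Y))).
Proof.
rewrite /adj_count big_mkcond; apply: eq_bigr => S _; case: (S \in X).
  rewrite big_mkcond; apply: eq_bigr => U _.
  by case: (U \in Y); rewrite ?andbT ?andbF.
by rewrite big1 // => U _; rewrite andbF.
Qed.

Lemma adj_countC (V : finType) (adj : rel V) r (X Y : {set {ffun 'I_r -> V}}) :
  symmetric adj -> adj_count adj X Y = adj_count adj Y X.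
Proof.
move=> symA; rewrite /adj_count exchange_big /=.
by do 2![apply: eq_bigr => ? _]; rewrite tuple_adjC.
Qed.

Lemma adj_count_le (V : finType) (adj : rel V) r (X Y : {set {ffun 'I_r -> V}}) :
  adj_count adj X Y <= \sum_(S in X) #|common_nbh adj S| ^ r.
Proof.
apply: leq_sum => S _; rewrite -card_tuple_adj card_sum big_mkcond /=.
by apply: leq_sum => U _; case: (U \in Y).
Qed.

(** The two bounds on [walks_norm B k.+1] are compared, with [(P * Q) ^ s * maxn P Q] bounding the
    product of a degree and a clash-constrained degree across an edge. *)
Lemma free_pair (V : finType) (E : {set {set V}}) s k (X Y : {set {ffun 'I_s.+1 -> V}}) P Q :
    ~~ contains_subgraph (blowup_edges (cycle_edges (2 * k.+1)) s.+1) E ->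
    (forall S, S \in X -> #|common_nbh (edge_rel E) S| <= P) ->
    (forall S, S \in Y -> #|common_nbh (edge_rel E) S| <= Q) ->
  adj_count (edge_rel E) X Y ^ (2 * k.+1) <= (#|X| * #|Y|) ^ k.+1 *
    ((4 * k.+1 ^ 4 * (2 * s.+1 ^ 2 * ((P * Q) ^ s * maxn P Q))) ^ k *
      (2 * adj_count (edge_rel E) X Y)).
Proof.
move=> free leP leQ; set e := adj_count _ _ _.
(* [X] and [Y] may overlap, hence the symmetrised definition. *)
pose B S U := tuple_adj (edge_rel E) S U &&
  ((S \in X) && (U \in Y) || (S \in Y) && (U \in X)).
have symB : symmetric B.
  move=> S U; rewrite /B tuple_adjC; last exact: edge_relC.
  by rewrite orbC ![(_ \in Y) && _]andbC.
have eE : e = \sum_(S in X) \sum_(U in Y) B S U.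
  rewrite /e /adj_count; apply: eq_bigr => S SX; apply: eq_bigr => U UY.
  by rewrite /B SX UY /= andbT.
have norm1 : walks_norm B 1 <= 2 * e.
  rewrite walks_norm1 mul2n -addnn {2}[e]adj_countC; last exact: edge_relC.
  rewrite /e !adj_countE -big_split /=; apply: leq_sum => S _; rewrite -big_split /=.
  apply: leq_sum => U _; rewrite /B.
  by case: (tuple_adj _ _ _); case: (S \in X); case: (S \in Y); case: (U \in X); case: (U \in Y).
have [x0 _|X0] := pickP (mem X); last first.
  by rewrite /e /adj_count big_pred0 // exp0n.
rewrite {1}eE (leq_trans (walks_norm_lower X Y k symB)) // leq_mul2l; apply/orP; right.
apply: leq_trans (leq_mul (leqnn _) norm1).
apply: (@walks_norm_le _ B (@clash V s.+1) k
  (2 * s.+1 ^ 2 * ((P * Q) ^ s * maxn P Q)) x0 symB) => [u z|t cyc].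
  apply: (clash_degree_le (adj := edge_rel E)) => // S U; first by case/andP.
  have bound a b P' Q' : a <= P' -> b <= Q' -> P' <= maxn P Q -> P' * Q' = P * Q ->
      a ^ s.+1 * b ^ s <= (P * Q) ^ s * maxn P Q.
    move=> aP bQ maxP <-; rewrite expnS expnMn -mulnA mulnC leq_mul //.
      by rewrite leq_mul // leq_expl.
    exact: leq_trans maxP.
  case/andP=> _ /orP[]/andP[SX UX].
    by apply: (bound _ _ P Q); rewrite ?leq_maxl ?leP ?leQ.
  by apply: (bound _ _ Q P); rewrite ?leq_maxr ?leP ?leQ // mulnC.
apply: (clash_of_free x0 free) => //; apply: sub_cycle cyc => S U; by case/andP.
Qed.

(** The exponents of [M] agree on both sides, as [s * k + k + s.+1 = s.+1 * k.+1]. With [M] the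
    larger degree scale, only the smaller one, [m], survives. *)
Lemma cancel_powers m M C N s k : 0 < m -> 0 < M ->
  (m * M) ^ (s.+1 * k.+1) <= C * ((m * M) ^ s * M) ^ k * (N * M ^ s.+1) ->
  m ^ (s.+1 + k) <= C * N.
Proof.
move=> m0 M0 le; rewrite -(@leq_pmul2r (m ^ (s * k) * M ^ (s.+1 * k.+1))); last first.
  by rewrite muln_gt0 !expn_gt0 m0 M0.
rewrite mulnA -expnD; have -> : s.+1 + k + s * k = s.+1 * k.+1 by lia.
rewrite -expnMn (leq_trans le) // leq_eqVlt; apply/orP; left; apply/eqP.
rewrite !expnMn -!expnM (_ : s.+1 * k.+1 = s * k + (k + s.+1)); last by lia.
rewrite !expnD; move: (m ^ _) (M ^ (s * k)) (M ^ k) (M ^ s.+1) => a b c d.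
lia.
Qed.

(** The factor [A] measures how far [X] and [Y] are from having average degrees [P ^ s.+1] and
    [Q ^ s.+1]. It is used to replace [#|X| * #|Y|] in [free_pair] by a multiple of [e ^ 2]. *)
Lemma free_pair_small (V : finType) (E : {set {set V}}) s k
    (X Y : {set {ffun 'I_s.+1 -> V}}) P Q A N :
    ~~ contains_subgraph (blowup_edges (cycle_edges (2 * k.+1)) s.+1) E ->
    (forall S, S \in X -> #|common_nbh (edge_rel E) S| <= P) ->
    (forall S, S \in Y -> #|common_nbh (edge_rel E) S| <= Q) ->
    0 < P -> 0 < Q ->
  forall e, e = adj_count (edge_rel E) X Y ->
    0 < e -> #|X| * P ^ s.+1 <= A * e -> #|Y| * Q ^ s.+1 <= A * e ->
    e <= N * P ^ s.+1 -> e <= N * Q ^ s.+1 ->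
  minn P Q ^ (s.+1 + k) <=
    2 * (8 * k.+1 ^ 4 * s.+1 ^ 2) ^ k * A ^ (2 * k.+1) * N.
Proof.
move=> free leP leQ P0 Q0 e eE e0 cardX cardY eP eQ.
have := free_pair free leP leQ; rewrite -eE => le.
apply: (@cancel_powers _ (maxn P Q)); first by rewrite leq_min P0.
  by rewrite leq_max P0.
have -> : minn P Q * maxn P Q = P * Q by rewrite /minn /maxn; case: ltnP => _ //; exact: mulnC.
rewrite -(@leq_pmul2r (e ^ (2 * k.+1))); last by rewrite expn_gt0 e0.
rewrite (leq_trans (leq_mul (leqnn _) le)) //.
have cXY : (P * Q) ^ (s.+1 * k.+1) * (#|X| * #|Y|) ^ k.+1
    <= A ^ (2 * k.+1) * e ^ (2 * k.+1).
  rewrite expnM -expnMn -[X in _ <= X]expnMn expnM leq_exp2r //.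
  rewrite -[X in _ <= X]mulnn (leq_trans _ (leq_mul cardX cardY)) // expnMn; lia.
(* This handles the one factor [e] left over from the number of edges in [free_pair]. *)
have eM : e <= N * maxn P Q ^ s.+1 by rewrite /maxn; case: ifP.
rewrite mulnA (leq_trans (leq_mul cXY (leqnn _))) //.
set R := (P * Q) ^ s * maxn P Q.
have -> : 4 * k.+1 ^ 4 * (2 * s.+1 ^ 2 * R) = 8 * k.+1 ^ 4 * s.+1 ^ 2 * R by lia.
rewrite [(8 * k.+1 ^ 4 * s.+1 ^ 2 * R) ^ k]expnMn.
apply: (@leq_trans (A ^ (2 * k.+1) * e ^ (2 * k.+1) *
   ((8 * k.+1 ^ 4 * s.+1 ^ 2) ^ k * R ^ k * (2 * (N * maxn P Q ^ s.+1))))).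
  by rewrite !leq_mul.
by rewrite leq_eqVlt; apply/orP; left; apply/eqP; lia.
Qed.

(** * Dyadic classes and the upper bound on adjacent pairs *)

(** The number of homomorphisms from [K_{r,r}], as a sum of degrees in the tuple graph. *)
Definition tuple_edges (V : finType) (adj : rel V) r : nat :=
  \sum_(S : {ffun 'I_r -> V}) #|common_nbh adj S| ^ r.

Lemma tuple_edgesE (V : finType) (adj : rel V) r :
  tuple_edges adj r = adj_count adj [set: {ffun 'I_r -> V}] setT.
Proof.
rewrite adj_countE; apply: eq_bigr => S _; rewrite -card_tuple_adj card_sum.
by apply: eq_bigr => U _; rewrite !in_setT /= andbT.
Qed.

(* The complement carries at most a quarter of the adjacent pairs. *)
Definition high (V : finType) (adj : rel V) r : {set {ffun 'I_r -> V}} :=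
  [set S | tuple_edges adj r <= 4 * #|V| ^ r * #|common_nbh adj S| ^ r].

(** A lost pair has its first or its second tuple outside [high]; each case costs at most a
    quarter. *)
Lemma high_edges (V : finType) (adj : rel V) r : symmetric adj ->
  tuple_edges adj r <= 2 * adj_count adj (high adj r) (high adj r).
Proof.
move=> symA; set H := high adj r; set t := tuple_edges adj r.
have low : 4 * \sum_(S in ~: H) #|common_nbh adj S| ^ r <= t.
  have cardT : #|{ffun 'I_r -> V}| = #|V| ^ r by rewrite card_ffun card_ord.
  have [V0|V0] := posnP (#|V| ^ r).
    rewrite big1 ?muln0 // => S _; have : 0 < #|{ffun 'I_r -> V}| by apply/card_gt0P; exists S.
    by rewrite cardT V0.
  rewrite -(leq_pmul2l V0) mulnA [_ * 4]mulnC big_distrr /=.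
  apply: (@leq_trans (\sum_(S in ~: H) t)).
    by apply: leq_sum => S; rewrite !inE -ltnNge => /ltnW.
  by rewrite sum_nat_const leq_mul2r -cardT max_card orbT.
have split_t : t <= adj_count adj H H + 2 * \sum_(S in ~: H) #|common_nbh adj S| ^ r.
  have le := adj_count_le adj (~: H) setT.
  apply: (@leq_trans (adj_count adj H H +
    (adj_count adj (~: H) setT + adj_count adj setT (~: H)))); last first.
    by rewrite leq_add2l mul2n -addnn leq_add // adj_countC.
  rewrite /t tuple_edgesE !adj_countE -!big_split /=; apply: leq_sum => S _.
  rewrite -!big_split /=; apply: leq_sum => U _; rewrite !in_setT !in_setC.
  by case: (tuple_adj adj S U) => //=; case: (S \in H); case: (U \in H).
lia.
Qed.

Definition dyadic (V : finType) (adj : rel V) r i : {set {ffun 'I_r -> V}} :=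
  [set S in high adj r | trunc_log 2 #|common_nbh adj S| == i].

(** Pigeonhole over the pairs of levels: if every pair failed, summing the strict inequalities would
    contradict [high_edges]. *)
Lemma dyadic_edges (V : finType) (adj : rel V) r : symmetric adj ->
  exists i j, tuple_edges adj r <=
    2 * (trunc_log 2 #|V|).+1 ^ 2 * adj_count adj (dyadic adj r i) (dyadic adj r j).
Proof.
move=> symA; set L := (trunc_log 2 #|V|).+1; set t := tuple_edges adj r.
pose c i j := adj_count adj (dyadic adj r i) (dyadic adj r j).
have part : adj_count adj (high adj r) (high adj r) = \sum_(i < L) \sum_(j < L) c i j.
  pose lev (S : {ffun 'I_r -> V}) : 'I_L := inord (trunc_log 2 #|common_nbh adj S|).
  have dyE i S : (S \in dyadic adj r (i : 'I_L)) = (S \in high adj r) && (lev S == i).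
    rewrite !inE; congr andb; rewrite -val_eqE /= inordK // ltnS.
    by apply: leq_trunc_log; apply: max_card.
  have split_sum (F : {ffun 'I_r -> V} -> nat) : \sum_(S in high adj r) F S =
      \sum_(i < L) \sum_(S in dyadic adj r i) F S.
    rewrite (partition_big lev predT) //=; apply: eq_bigr => i _.
    by apply: eq_bigl => S; rewrite dyE.
  rewrite /adj_count split_sum; apply: eq_bigr => i _.
  rewrite exchange_big /= split_sum; apply: eq_bigr => j _.
  by rewrite /c /adj_count exchange_big.
have [p /= le_p|noP] := pickP (fun p : 'I_L * 'I_L => t <= 2 * L ^ 2 * c p.1 p.2).
  by exists p.1, p.2.
have := high_edges r symA; rewrite part pair_bigA /= -/t => le.
have : \sum_(p : 'I_L * 'I_L) (2 * L ^ 2 * c p.1 p.2).+1 <= \sum_(p : 'I_L * 'I_L) t.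
  by apply: leq_sum => p _; rewrite ltnNge noP.
under eq_bigr do rewrite -addn1.
rewrite big_split /= -big_distrr /= !sum_nat_const card_prod card_ord.
have L0 : 0 < L by [].
move: le; set sm := \sum_p _; nia.
Qed.

Lemma tuple_edges_upper (V : finType) (E : {set {set V}}) s k :
    ~~ contains_subgraph (blowup_edges (cycle_edges (2 * k.+1)) s.+1) E ->
  tuple_edges (edge_rel E) s.+1 ^ (s.+1 + k) <=
    (4 * #|V| ^ s.+1) ^ (s.+1 + k) *
      (2 * (8 * k.+1 ^ 4 * s.+1 ^ 2) ^ k *
       (2 ^ s.+2 * (trunc_log 2 #|V|).+1 ^ 2) ^ (2 * k.+1) * #|V| ^ s.+1) ^ s.+1.
Proof.
move=> free; set t := tuple_edges _ _; set n := #|V|.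
set C := 2 * _ ^ k * _ ^ (2 * k.+1).
have [->|t0] := posnP t; first by rewrite exp0n // addSn.
have [i [j]] := dyadic_edges s.+1 (edge_relC E); rewrite -/t -/n.
set X := dyadic _ _ i; set Y := dyadic _ _ j; set e := adj_count _ X Y => le_t.
have e0 : 0 < e by case: (e) le_t => //; rewrite muln0 leqNgt t0.
have codeg l S : S \in dyadic (edge_rel E) s.+1 l ->
    [/\ t <= 4 * n ^ s.+1 * #|common_nbh (edge_rel E) S| ^ s.+1,
        2 ^ l <= #|common_nbh (edge_rel E) S|
      & #|common_nbh (edge_rel E) S| <= 2 ^ l.+1].
  rewrite !inE => /andP[le /eqP <-]; split=> //.
    (* A zero codegree would also have level 0, but [high] rules it out since [t] is positive. *)
    apply: trunc_logP => //; rewrite lt0n; apply: contraL t0 => /eqP c0.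
    by move: le; rewrite c0 exp0n // muln0 leqNgt.
  by apply: ltnW; apply: trunc_log_ltn.
have sum_dy l : \sum_(S in dyadic (edge_rel E) s.+1 l)
    #|common_nbh (edge_rel E) S| ^ s.+1 <= n ^ s.+1 * (2 ^ l.+1) ^ s.+1.
  apply: (@leq_trans (\sum_(S in dyadic (edge_rel E) s.+1 l) (2 ^ l.+1) ^ s.+1)).
    by apply: leq_sum => S /codeg[_ _ le]; apply: leq_expl.
  rewrite sum_nat_const leq_mul2r (leq_trans (max_card _)) ?orbT //.
  by rewrite card_ffun card_ord.
(* Replacing codegrees by the upper end of their class costs [2 ^ s.+1]; passing from [t] to [e]
   costs [2] and the squared number of levels. *)
have card_dy l : #|dyadic (edge_rel E) s.+1 l| * (2 ^ l.+1) ^ s.+1 <=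
    2 ^ s.+2 * (trunc_log 2 n).+1 ^ 2 * e.
  apply: (@leq_trans (2 ^ s.+1 * t)); last first.
    apply: leq_trans (leq_mul (leqnn _) le_t) _.
    by rewrite [2 ^ s.+2]expnSr; move: (2 ^ _) => a; lia.
  rewrite [2 ^ l.+1]expnS expnMn mulnCA leq_mul2l -sum_nat_const; apply/orP; right.
  rewrite /t /tuple_edges [X in _ <= X](bigID (mem (dyadic (edge_rel E) s.+1 l))) /=.
  rewrite (leq_trans _ (leq_addr _ _)) //; apply: leq_sum => S /codeg[_ le _].
  exact: leq_expl.
have small := @free_pair_small _ E s k X Y (2 ^ i.+1) (2 ^ j.+1)
  (2 ^ s.+2 * (trunc_log 2 n).+1 ^ 2) (n ^ s.+1) free.
have {small} := small _ _ _ _ e erefl e0 (card_dy i) (card_dy j) _ _.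
rewrite !expn_gt0 /= -/C => small.
set m := minn (2 ^ i.+1) (2 ^ j.+1).
have le_m : m ^ (s.+1 + k) <= C * n ^ s.+1.
  apply: small => // [S /codeg[]|S /codeg[]||] //.
    exact: leq_trans (adj_count_le _ _ _) (sum_dy _).
  rewrite /e adj_countC; last exact: edge_relC.
  exact: leq_trans (adj_count_le _ _ _) (sum_dy _).
(* Both classes are nonempty and lie in [high], so [t] is bounded through either scale, in
   particular through the smaller one, to which [le_m] applies. *)
have t_m : t <= 4 * n ^ s.+1 * m ^ s.+1.
  have nonempty (Z : {set {ffun 'I_s.+1 -> V}}) Z' :
      0 < adj_count (edge_rel E) Z Z' -> exists S, S \in Z.
    have [->|[S ZS] _] := set_0Vmem Z; last by exists S.
    by rewrite /adj_count big_set0.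
  have [S /codeg[leS _ leS']] := nonempty _ _ e0.
  have [U /codeg[leU _ leU']] : exists U, U \in Y.
    by apply: (nonempty _ X); rewrite adj_countC //; exact: edge_relC.
  rewrite /m /minn; case: ifP => _.
    by rewrite (leq_trans leS) // leq_mul2l leq_expl ?orbT.
  by rewrite (leq_trans leU) // leq_mul2l leq_expl ?orbT.
rewrite (leq_trans (leq_expl _ t_m)) // expnMn leq_mul2l; apply/orP; right.
by rewrite -expnM mulnC expnM leq_expl.
Qed.

(** * The lower bound on adjacent pairs and the bound on edges *)

(** The power mean inequality is used twice, as for Kovari-Sos-Turan: on vertex degrees, which
    counts stars with [s.+1] leaves, and on codegrees of the leaf tuples. *)
Lemma tuple_edges_lower (V : finType) (E : {set {set V}}) s : simple_edges E ->
  #|E| ^ (s.+1 ^ 2) <= #|V| ^ (2 * s * s.+1) * tuple_edges (edge_rel E) s.+1.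
Proof.
move=> /forall_inP simple; set n := #|V|; set adj := edge_rel E.
have edges : #|E| <= \sum_v #|adj v|.
  have -> : \sum_v #|adj v| = #|[set p : V * V | adj p.1 p.2]|.
    transitivity (\sum_(p : V * V) (adj p.1 p.2 : nat)).
      rewrite -(pair_bigA _ (fun u v => (adj u v : nat))); apply: eq_bigr => u _.
      exact: card_sum.
    by rewrite cardsE card_sum.
  apply: leq_trans (leq_imset_card (fun p : V * V => [set p.1; p.2]) _).
  apply: subset_leq_card; apply/subsetP => e eE.
  have /cards2P[u [v [uv e_uv]]] := simple e eE.
  by apply/imsetP; exists (u, v); rewrite // inE /adj /edge_rel -e_uv.
have stars : \sum_v #|adj v| ^ s.+1 = \sum_(S : {ffun 'I_s.+1 -> V}) #|common_nbh adj S|.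
  transitivity (\sum_v \sum_(S : {ffun 'I_s.+1 -> V}) (v \in common_nbh adj S)).
    apply: eq_bigr => v _.
    transitivity #|[set S : {ffun 'I_s.+1 -> V} | [forall a, adj (S a) v]]|.
      rewrite -[X in _ ^ X](card_ord s.+1) -card_ffun_on; apply: eq_card => S.
      rewrite inE; apply/ffun_onP/forallP => adjS a; have := adjS a;
        by rewrite /adj edge_relC.
    by rewrite cardsE card_sum; apply: eq_bigr => S _; rewrite inE.
  rewrite exchange_big; apply: eq_bigr => S _.
  by rewrite card_sum.
have := expn_sum_le (fun v => #|adj v|) s; rewrite stars -/n => le1.
have := expn_sum_le (fun S : {ffun 'I_s.+1 -> V} => #|common_nbh adj S|) s.
rewrite card_ffun card_ord -/(tuple_edges adj s.+1) -/n => le2.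
rewrite -mulnn expnM (leq_trans (leq_expl _ (leq_trans (leq_expl _ edges) le1))) //.
rewrite expnMn (leq_trans (leq_mul (leqnn _) le2)) // mulnA -!expnM -expnD.
by rewrite leq_eqVlt; apply/orP; left; apply/eqP; congr (_ ^ _ * _); lia.
Qed.

Lemma free_edges_bound (V : finType) (E : {set {set V}}) s k : simple_edges E ->
    ~~ contains_subgraph (blowup_edges (cycle_edges (2 * k.+1)) s.+1) E ->
  #|E| ^ (s.+1 ^ 2 * (s.+1 + k)) <=
    4 ^ (s.+1 + k) * (2 * (8 * k.+1 ^ 4 * s.+1 ^ 2) ^ k * (2 ^ s.+2) ^ (2 * k.+1)) ^ s.+1 *
    #|V| ^ (2 * s * s.+1 * (s.+1 + k) + s.+1 * (s.+1 + k) + s.+1 ^ 2) *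
    (trunc_log 2 #|V|).+1 ^ (4 * k.+1 * s.+1).
Proof.
move=> simple free; rewrite expnM.
rewrite (leq_trans (leq_expl _ (tuple_edges_lower s simple))) // expnMn.
rewrite (leq_trans (leq_mul (leqnn _) (tuple_edges_upper free))) //.
rewrite leq_eqVlt; apply/orP; left; apply/eqP.
rewrite (_ : 4 * k.+1 * s.+1 = 2 * k.+1 * s.+1 + 2 * k.+1 * s.+1); last by lia.
move: (2 * _ ^ k) (2 ^ s.+2) #|V| (trunc_log 2 _).+1 => K1 K2 n l.
move: s.+1 (s.+1 + k) (2 * k.+1) (2 * s) => b a c d.
rewrite !expnMn -!expnM !expnD -!mulnn.
move: (n ^ (d * b * a)) (n ^ (b * a)) (n ^ (b * b)) (K1 ^ b) (K2 ^ (c * b)) (4 ^ a).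
move=> x1 x2 x3 x4 x5 x6.
move: (l ^ (c * b)) => x7; lia.
Qed.

(** * Passage to real exponents *)

Lemma INR_le m n : m <= n -> Rle (INR m) (INR n).
Proof. by move/leP; exact: le_INR. Qed.

Lemma INR_muln m n : INR (m * n) = Rmult (INR m) (INR n).
Proof. exact: mult_INR. Qed.

Lemma INR_expn m e : INR (m ^ e) = pow (INR m) e.
Proof. by elim: e => //= e IHe; rewrite expnS INR_muln IHe. Qed.

Lemma INR_gt0 n : 0 < n -> Rlt R0 (INR n).
Proof. by move/ltP; exact: lt_0_INR. Qed.

Lemma trunc_log_le_log2 n : 0 < n -> Rle (INR (trunc_log 2 n)) (log2 (INR n)).
Proof.
move=> n0; have ln2 : Rlt R0 (ln (INR 2)).
  by rewrite -[R0]ln_1; apply: ln_increasing; rewrite /=; lra.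
apply: (Rmult_le_reg_r _ _ _ ln2).
rewrite /log2 /Rdiv Rmult_assoc Rinv_l; last by lra.
rewrite Rmult_1_r -ln_pow; last exact: INR_gt0.
rewrite -INR_expn.
have : Rle (INR (2 ^ trunc_log 2 n)) (INR n) by apply: INR_le; apply: trunc_logP.
case=> [lt|->]; last exact: Rle_refl.
by left; apply: ln_increasing => //; apply: INR_gt0; rewrite expn_gt0.
Qed.

(** A [D]-th root is taken. The factor [pow 2 b] pays for replacing [l] by [x]; positivity of the
    bases is needed for the [Rpower] laws. *)
Lemma root_bound e K n l D a b (x : R) : 0 < e -> 0 < K -> 0 < n -> 0 < D ->
    e ^ D <= K * n ^ a * l ^ b -> Rlt R0 x -> Rle (INR l) (Rmult 2 x) ->
  Rle (INR e) (Rmult (Rmult (Rpower (Rmult (INR K) (pow 2 b)) (Rdiv R1 (INR D)))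
                 (Rpower (INR n) (Rdiv (INR a) (INR D))))
                 (Rpower x (Rdiv (INR b) (INR D)))).
Proof.
move=> e0 K0 n0 D0 le x0 lx.
have [[eR KR] [nR DR]] := conj (conj (INR_gt0 e0) (INR_gt0 K0)) (conj (INR_gt0 n0) (INR_gt0 D0)).
have DnR : INR D <> R0 by lra.
have -> : INR e = Rpower (INR (e ^ D)) (Rdiv R1 (INR D)).
  rewrite INR_expn -Rpower_pow // Rpower_mult (_ : Rmult _ _ = R1) ?Rpower_1 //.
  by field.
have two0 : Rlt R0 (pow 2 b) by apply: pow_lt; lra.
have xb0 : Rlt R0 (pow x b) by apply: pow_lt.
have na0 : Rlt R0 (pow (INR n) a) by apply: pow_lt.
apply: (Rle_trans _ (Rpower (Rmult (Rmult (Rmult (INR K) (pow 2 b)) (pow (INR n) a))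
   (pow x b)) (Rdiv R1 (INR D)))).
  apply: Rle_Rpower_l; first by left; apply: Rdiv_lt_0_compat => //; lra.
  split; first by apply: INR_gt0; rewrite expn_gt0 e0.
  apply: Rle_trans (INR_le le) _; rewrite !INR_muln !INR_expn.
  have lb : Rle (pow (INR l) b) (Rmult (pow 2 b) (pow x b)).
    rewrite -Rpow_mult_distr; apply: pow_incr; split=> //; exact: pos_INR.
  have Kn : Rle R0 (Rmult (INR K) (pow (INR n) a)) by apply: Rmult_le_pos; lra.
  have := Rmult_le_compat_l _ _ _ Kn lb; lra.
have K2 : Rlt R0 (Rmult (INR K) (pow 2 b)) by apply: Rmult_lt_0_compat.
rewrite -!Rpower_mult_distr //; last by apply: Rmult_lt_0_compat.
rewrite -(Rpower_pow a) // -(Rpower_pow b x) // !Rpower_mult.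
have -> : Rmult (INR a) (Rdiv R1 (INR D)) = Rdiv (INR a) (INR D) by field.
have -> : Rmult (INR b) (Rdiv R1 (INR D)) = Rdiv (INR b) (INR D) by field.
exact: Rle_refl.
Qed.

Lemma ex_bound s k n :
  ex (blowup_edges (cycle_edges (2 * k.+1)) s.+1) n ^ (s.+1 ^ 2 * (s.+1 + k)) <=
    4 ^ (s.+1 + k) * (2 * (8 * k.+1 ^ 4 * s.+1 ^ 2) ^ k * (2 ^ s.+2) ^ (2 * k.+1)) ^ s.+1 *
    n ^ (2 * s * s.+1 * (s.+1 + k) + s.+1 * (s.+1 + k) + s.+1 ^ 2) *
    (trunc_log 2 n).+1 ^ (4 * k.+1 * s.+1).
Proof.
rewrite /ex; elim/big_ind: _ => [|x y|E /andP[simple free]].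
- by rewrite exp0n // muln_gt0 expn_gt0.
- by rewrite /maxn; case: ifP.
by have := free_edges_bound simple free; rewrite card_ord.
Qed.

Theorem theorem1p15 (r k : nat) (hr : (1 <= r)%N) (hk : (2 <= k)%N) :
  exists C : R, Rlt R0 C /\ exists N : nat, forall n : nat, (N <= n)%N ->
    Rle (INR (ex (blowup_edges (cycle_edges (2 * k)) r) n))
        (Rmult (Rmult C
           (Rpower (INR n)
              (Rplus (Rminus (INR 2) (Rdiv R1 (INR r))) (Rdiv R1 (INR (k + r - 1))))))
           (Rpower (log2 (INR n)) (Rdiv (INR (4 * k)) (Rmult (INR r) (INR (k + r - 1)))))).
Proof.
(* From here on [s] is [r - 1], and [k] stands for the original [k] minus one. *)
case: r hr => // s _; case: k hk => // k _.
set K := 4 ^ (s.+1 + k) *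
  (2 * (8 * k.+1 ^ 4 * s.+1 ^ 2) ^ k * (2 ^ s.+2) ^ (2 * k.+1)) ^ s.+1.
have K0 : 0 < K by rewrite !(muln_gt0, expn_gt0).
set D := s.+1 ^ 2 * (s.+1 + k).
have D0 : 0 < D by rewrite !(muln_gt0, expn_gt0).
exists (Rpower (Rmult (INR K) (pow 2 (4 * k.+1 * s.+1))) (Rdiv R1 (INR D))).
split; first exact: exp_pos.
(* For [n >= 2] the logarithm is at least one, so the added one in [(trunc_log 2 n).+1] is absorbed
   by a factor 2. *)
exists 2 => n n2; have n0 : 0 < n by exact: ltnW.
have log_n := trunc_log_le_log2 n0.
have log1 : Rle 1 (INR (trunc_log 2 n)).
  by apply: (INR_le (m := 1)); apply: trunc_log_max.
have [->|e0] := posnP (ex (blowup_edges (cycle_edges (2 * k.+1)) s.+1) n).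
  by left; apply: Rmult_lt_0_compat; [apply: Rmult_lt_0_compat|]; exact: exp_pos.
have lx : Rle (INR (trunc_log 2 n).+1) (Rmult 2 (log2 (INR n))) by rewrite S_INR; lra.
have x0 : Rlt R0 (log2 (INR n)) by lra.
have := root_bound e0 K0 n0 D0 (ex_bound s k n) x0 lx.
have sR : INR s.+1 <> R0 by apply: not_0_INR.
have pR : INR (s.+1 + k) <> R0 by apply: not_0_INR.
have -> : k.+1 + s.+1 - 1 = s.+1 + k by lia.
(* The three summands give [2 s / r], [1 / r] and [1 / (s + 1 + k)], where [r = s + 1]; the first
   two add up to [2 - 1 / r]. *)
have -> : Rdiv (INR (2 * s * s.+1 * (s.+1 + k) + s.+1 * (s.+1 + k) + s.+1 ^ 2)) (INR D) =
    Rplus (Rminus (INR 2) (Rdiv R1 (INR s.+1))) (Rdiv R1 (INR (s.+1 + k))).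
  rewrite /D; move: (s.+1 + k) pR => a aR.
  have sE : INR s = Rminus (INR s.+1) 1 by rewrite S_INR; lra.
  rewrite -!mulnn !(plus_INR, INR_muln) sE [INR 2]/=.
  by field.
have -> : Rdiv (INR (4 * k.+1 * s.+1)) (INR D) =
    Rdiv (INR (4 * k.+1)) (Rmult (INR s.+1) (INR (s.+1 + k))).
  by rewrite /D -mulnn [4 * k.+1]lock !INR_muln; field.
by [].
Qed.
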